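(* Suppose $0<s<1$, $0<\lambda<1$, $0<\delta\leq 1/4$, and $N\geq 1$ is an integer. Put $\nu=1-\lambda$. Then $$s-\frac{1}{\nu N}<\bar{\epsilon}_{\lambda}(\lfloor \nu s N\rfloor,N,\delta)\leq s+\frac{1}{\nu\lambda}\sqrt{\frac{s\ln\delta^{-1}}{N}}+\frac{\ln\delta^{-1}}{2\nu^2\lambda N}+\frac{2}{\lambda N}.$$
   Context: Target state. Let $d$ be a prime, $n\ge 1$, $\mathcal{H}=(\mathbb{C}^d)^{\otimes n}$, $\omega=e^{2\pi \mathrm{i}/d}$, and let $Z|j\rangle=\omega^j|j\rangle$ for $j\in\mathbb{Z}_d$. Given a graph with vertex set $\{1,\dots,n\}$, edge set $E$ (edges join distinct vertices) and multiplicities $m_e\in\mathbb{Z}_d$ for $e\in E$, the qudit graph state is $|G\rangle=\big(\prod_{e\in E}\mathrm{CZ}_e^{m_e}\big)|+\rangle^{\otimes n}\in\mathcal{H}$, where $|+\rangle=d^{-1/2}\sum_{j\in\mathbb{Z}_d}|j\rangle$ and $\mathrm{CZ}_{(i,j)}=\sum_{k\in\mathbb{Z}_d}|k\rangle\langle k|_i\otimes Z_j^k$. Strategy. For a parameter $\lambda$ put $\nu=1-\lambda$, $\Omega=|G\rangle\langle G|+\lambda(\mathbb{1}-|G\rangle\langle G|)$ and $\overline{\Omega}=\mathbb{1}-\Omega$. Guaranteed infidelity. For integers $0\leq k\leq N-1$ and a permutation-invariant density operator $\rho$ on $\mathcal{H}^{\otimes(N+1)}$ (i.e. invariant under conjugation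 by all permutations of the $N+1$ tensor factors), let $$p_k(\rho)=\sum_{i=0}^k\binom{N}{i}\operatorname{tr}\big([\Omega^{\otimes(N-i)}\otimes\overline{\Omega}^{\otimes i}\otimes\mathbb{1}]\rho\big),\qquad f_k(\rho)=\sum_{i=0}^k\binom{N}{i}\operatorname{tr}\big([\Omega^{\otimes(N-i)}\otimes\overline{\Omega}^{\otimes i}\otimes|G\rangle\langle G|]\rho\big),$$ and $F_k(\rho)=f_k(\rho)/p_k(\rho)$ when $p_k(\rho)>0$. ($p_k(\rho)$ is the probability that at most $k$ of $N$ tests fail, and $F_k(\rho)$ is the fidelity of the resulting conditional state of the last system with $|G\rangle$.) For $0<\delta\leq 1$ define $$\bar{\epsilon}_{\lambda}(k,N,\delta)=1-\min_{\rho}\{F_k(\rho)\mid p_k(\rho)\geq\delta\},$$ the minimum being over permutation-invariant density operators $\rho$ on $\mathcal{H}^{\otimes(N+1)}$. *)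

(* Defs.v *)
From mathcomp Require Import all_boot all_order all_algebra all_fingroup.
From mathcomp Require Import spectral.
From mathcomp Require Import all_classical all_reals all_analysis.
From mathcomp Require Import complex.

Set Implicit Arguments.
Unset Strict Implicit.
Unset Printing Implicit Defensive.

Import Order.TTheory GRing.Theory Num.Theory.

Local Open Scope ring_scope.
Local Open Scope complex_scope.
Local Open Scope sesquilinear_scope.

(* The order on R[i] is the partial one: z1 <= z2 iff z2 - z1 is a nonnegative
   real.  In particular "0 <= z" contains the assertion that z is real. *)

Section TensorPower.
Variables (C : numClosedFieldType) (D m : nat).

(* (C^D)^{(x) m} is C^M with M = #|{ffun 'I_m -> 'I_D}|: its computational basis
   is indexed by functions x, |x> = |x_0> (x) ... (x) |x_(m-1)>, which enum_val
   numbers. *)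
Definition tdim : nat := #|{ffun 'I_m -> 'I_D}|.

Definition tbasis (a : 'I_tdim) : {ffun 'I_m -> 'I_D} := enum_val a.

Definition tensv (v : 'I_m -> 'cV[C]_D) : 'cV[C]_tdim :=
  \col_a \prod_(l < m) v l (tbasis a l) 0.

Definition tensop (A : 'I_m -> 'M[C]_D) : 'M[C]_tdim :=
  \matrix_(a, b) \prod_(l < m) A l (tbasis a l) (tbasis b l).

Definition siteop (i : 'I_m) (A : 'M[C]_D) : 'M[C]_tdim :=
  tensop (fun l => if l == i then A else 1%:M).

(* permop g |y> = |y \o g|, the unitary permuting the m tensor factors. *)
Definition permop (g : 'S_m) : 'M[C]_tdim :=
  \matrix_(a, b) (tbasis a == [ffun l => tbasis b (g l)])%:R.

Definition perm_invariant (rho : 'M[C]_tdim) : Prop :=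
  forall g : 'S_m, permop g *m rho *m (permop g)^t* = rho.

End TensorPower.

(* Hermitian symmetry is implied by the reality of the quadratic form. *)
Definition density (C : numClosedFieldType) (M : nat) (rho : 'M[C]_M) : Prop :=
  (forall v : 'cV[C]_M, 0 <= (v^t* *m rho *m v) 0 0) /\ \tr rho = 1.

Section GraphState.
Variables (R : realType) (d n : nat).

(* Z_d is represented by the residues 'I_d, which only occur as basis labels
   and as exponents of operators of order d. *)

Definition omega : R[i] := cos (2 * pi / d%:R) +i* sin (2 * pi / d%:R).

Definition Zop : 'M[R[i]]_d :=
  \matrix_(a, b) (if a == b then omega ^+ b else 0).

Definition plus_state : 'cV[R[i]]_d := const_mx ((Num.sqrt d%:R)^-1)%:C.

Definition CZ (e : 'I_n * 'I_n) : 'M[R[i]]_(tdim d n) :=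
  \sum_(k < d) siteop e.1 (delta_mx k k) *m siteop e.2 (Zop ^+ k).

(* An edge is a pair of vertices in either orientation (CZ (i, j) = CZ (j, i)).
   The factors are diagonal, so their order is immaterial. *)
Definition graph_state (E : {set 'I_n * 'I_n}) (mult : 'I_n * 'I_n -> 'I_d) :
    'cV[R[i]]_(tdim d n) :=
  (\prod_(e in E) CZ e ^+ mult e) *m tensv (fun=> plus_state).

End GraphState.

Section Verification.
Variables (R : realType) (D : nat) (G : 'cV[R[i]]_D) (lambda : R).

Definition target_proj : 'M[R[i]]_D := G *m G^t*.

Definition Omega : 'M[R[i]]_D :=
  target_proj + lambda%:C *: (1%:M - target_proj).

Definition Omegabar : 'M[R[i]]_D := 1%:M - Omega.

(* Omega^{(x) (N - i)} (x) Omegabar^{(x) i} (x) A, for i <= N. *)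
Definition test_op (N i : nat) (A : 'M[R[i]]_D) : 'M[R[i]]_(tdim D N.+1) :=
  tensop (fun l : 'I_N.+1 =>
    if (l < N - i)%N then Omega else if (l < N)%N then Omegabar else A).

Definition test_sum (k N : nat) (A : 'M[R[i]]_D)
    (rho : 'M[R[i]]_(tdim D N.+1)) : R[i] :=
  \sum_(0 <= i < k.+1) ('C(N, i))%:R * \tr (test_op N i A *m rho).

Definition pk (k N : nat) (rho : 'M[R[i]]_(tdim D N.+1)) : R[i] :=
  test_sum k 1%:M rho.

Definition fk (k N : nat) (rho : 'M[R[i]]_(tdim D N.+1)) : R[i] :=
  test_sum k target_proj rho.

Definition Fk (k N : nat) (rho : 'M[R[i]]_(tdim D N.+1)) : R[i] :=
  fk k rho / pk k rho.

Definition admissible (k N : nat) (delta : R)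
    (rho : 'M[R[i]]_(tdim D N.+1)) : Prop :=
  [/\ density rho, perm_invariant rho & delta%:C <= pk k rho].

(* eps = 1 - min {Fk rho | rho admissible}: this includes that the minimum is
   attained. *)
Definition is_guaranteed_infidelity (k N : nat) (delta eps : R) : Prop :=
  (exists2 rho : 'M[R[i]]_(tdim D N.+1),
     admissible k delta rho & Fk k rho = (1 - eps)%:C) /\
  (forall rho : 'M[R[i]]_(tdim D N.+1),
     admissible k delta rho -> (1 - eps)%:C <= Fk k rho).

End Verification.

(* Main.v *)
Require Import Defs.
From mathcomp Require Import all_boot all_order all_algebra all_fingroup.
From mathcomp Require Import all_classical all_reals all_analysis.
From mathcomp Require Import complex spectral.
From mathcomp Require Import zify ring lra.

Set Implicit Arguments.
Unset Strict Implicit.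
Unset Printing Implicit Defensive.

Import Order.TTheory GRing.Theory Num.Theory.
Import numFieldNormedType.Exports.
Local Open Scope ring_scope.

(* Measuring the target projector P or its complement Q on each of the N + 1
   sites turns a permutation-invariant state into an exchangeable probability
   weight w on the set x of bad sites; conversely every such weight comes from a
   state.  Both p_k and f_k are linear in w, so the minimum is attained by
   compactness.

   Lower bound: if the sites are independently bad with probability
   r = k / (nu N), the infidelity is exactly r, and p_k is the probability that
   a binomial variable of integral mean k is at most k, which is >= 1/4.

   Upper bound: also test the last site, and let S be the set of failed sites.
   A bad site passes with probability lambda, so by exchangeability
   lambda (N + 1) (p_k - f_k) = E[ |x \ S| ; |S| <= k ].  If
   (1 - nu) e^a + nu e^-b <= 1, then E[ e^(a |x \ S| - b |S|) ] <= 1, and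
   y <= L - 1 + e^-L e^y with L = ln (1 / delta) >= 1 and e^-L <= p_k gives
   a E[ |x \ S| ; |S| <= k ] <= (L + b k) p_k.  Hoeffding's bound on the
   Bernoulli moment generating function provides suitable a and b. *)

(** * Real inequalities *)

Lemma ge0_derive_ge0 (R : realType) (f df : R -> R) (c : R) :
  (forall x : R, is_derive x 1 f (df x)) -> (forall x : R, 0 <= x -> 0 <= df x) ->
  f 0 = 0 -> 0 <= c -> 0 <= f c.
Proof.
move=> fdf df0 f0 c0.
have [|x /andP[+ _] ] := @MVT_segment R f df 0 c c0 (fun x _ => fdf x).
  by apply: derivable_within_continuous => x _; have [] := fdf x.
by rewrite bnd_simp f0 !subr0 => x0 ->; rewrite mulr_ge0 ?df0.
Qed.

(** Let [f] be the difference of the exponents. Then f(0) = f'(0) = 0, and f'' = 1/4 - t (1 - t)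
    with t = nu e^-x / D(x), the tilted Bernoulli parameter. Since t (1 - t) <= 1/4,
    [ge0_derive_ge0] applies first to f' and then to f. *)
Lemma hoeffding_bernoulli (R : realType) (nu c : R) :
  0 <= nu < 1 -> 0 <= c ->
  1 - nu + nu * expR (- c) <= expR (c ^+ 2 / 8 - nu * c).
Proof.
move=> /andP[nu0 nu1] c0.
pose D (x : R) : R := 1 - nu + nu * expR (- x).
have D0 x : 0 < D x by rewrite ltr_wpDr ?subr_gt0 // mulr_ge0 ?expR_ge0.
have dD (x : R) : is_derive x 1 D (- (nu * expR (- x))).
  by apply: is_derive_eq; rewrite /GRing.scale /=; ring.
pose f1 (x : R) := x / 4 - nu + nu * expR (- x) / D x.
pose f (x : R) := x ^+ 2 / 8 - nu * x - ln (D x).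
have df (x : R) : is_derive x 1 f (f1 x).
  have dl := is_derive1_ln (D0 x).
  have dlD : is_derive x 1 (@ln R \o D) (- (nu * expR (- x)) / D x).
    by apply: is_derive_eq; rewrite /GRing.scale /= mulrC.
  rewrite /f -[fun x : R => _]/((fun x : R => x ^+ 2 / 8 - nu * x) - (@ln R \o D)).
  apply: is_derive_eq.
  by rewrite /f1 /GRing.scale /=; field; rewrite gt_eqF.
have df1 (x : R) : is_derive x 1 f1 (1 / 4 - (1 - nu) * (nu * expR (- x)) / D x ^+ 2).
  have dV : is_derive x 1 (fun x : R => (D x)^-1) (- D x ^- 2 *: - (nu * expR (- x))).
    by apply: is_deriveV; rewrite gt_eqF.
  rewrite /f1.
  apply: is_derive_eq.
  rewrite /GRing.scale /= /D; field.
  by have := D0 x; rewrite /D => /gt_eqF ->.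
have f1_ge0 x : 0 <= x -> 0 <= f1 x.
  apply: ge0_derive_ge0 df1 _ _ => [y _|].
    rewrite subr_ge0 ler_pdivrMr ?exprn_gt0 //.
    rewrite /D; set e := nu * _; rewrite -subr_ge0.
    have -> : 1 / 4 * (1 - nu + e) ^+ 2 - (1 - nu) * e = ((1 - nu - e) / 2) ^+ 2 by field.
    exact: sqr_ge0.
  by rewrite /f1 /D oppr0 expR0; field; lra.
have : 0 <= f c.
  apply: ge0_derive_ge0 df f1_ge0 _ c0.
  by rewrite /f /D oppr0 expR0 mulr1 subrK ln1; field.
by rewrite /f subr_ge0 -ler_expR lnK // posrE D0.
Qed.

(** With b = c - a the exponential condition reads e^a (1 - nu + nu e^-c) <= 1, which
    [hoeffding_bernoulli] gives for a = nu c - c^2 / 8. The last inequality becomes L + nu s n c <=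
    T a with T = s n + w, and c remains to be chosen. *)
Lemma chernoff_parameters (R : realType) (nu s L n : R)
  (w := Num.sqrt (s * n * L) / nu + L / (2 * nu ^+ 2)) :
  0 < nu < 1 -> 0 < s -> 0 < L -> 0 < n ->
  exists a b : R, [/\ 0 < a, 0 <= b, (1 - nu) * expR a + nu * expR (- b) <= 1 &
    L + b * (nu * s * n) <= (s * n * (1 - nu) + w) * a].
Proof.
move=> /andP[nu0 nu1] s0 L0 n0.
set q := Num.sqrt _ in w *.
have q2 : q ^+ 2 = s * n * L by rewrite sqr_sqrtr // !mulr_ge0 // ltW.
have q0 : 0 <= q by exact: sqrtr_ge0.
have w0 : 0 < w by rewrite ltr_wpDl ?divr_ge0 ?divr_gt0 ?mulr_gt0 ?exprn_gt0 // ltW.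
pose T := s * n + w.
have T0 : 0 < T by rewrite addr_gt0 ?mulr_gt0.
(* The shape of [w] serves this inequality: the two sides differ by s n L + q L / nu. *)
have key : L * T <= 2 * (nu * w) ^+ 2.
  have -> : nu * w = q + L / (2 * nu) by rewrite /w; field; rewrite gt_eqF.
  have -> : 2 * (q + L / (2 * nu)) ^+ 2 = 2 * q ^+ 2 + 2 * (q * L / nu) + L ^+ 2 / (2 * nu ^+ 2).
    by field; rewrite gt_eqF.
  rewrite q2.
  have -> : L * T = s * n * L + q * L / nu + L ^+ 2 / (2 * nu ^+ 2).
    by rewrite /T /w; field; rewrite gt_eqF.
  have : 0 <= q * L / nu by rewrite divr_ge0 ?mulr_ge0 // ltW.
  have : 0 <= s * n * L by rewrite !mulr_ge0 // ltW.
  lra.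
(* This [c] maximises T a - nu s n c = nu w c - T c^2 / 8; the maximum is 2 (nu w)^2 / T, which is
   at least L by [key]. *)
pose c := 4 * nu * w / T.
have c0 : 0 < c by rewrite divr_gt0 ?mulr_gt0.
pose a := nu * c - c ^+ 2 / 8.
have Ta : L + nu * s * n * c <= T * a.
  have -> : T * a = nu * s * n * c + 2 * (nu * w) ^+ 2 / T.
    by rewrite /a /c /T; field; rewrite gt_eqF.
  by rewrite addrC lerD2l ler_pdivlMr.
have a0 : 0 < a.
  rewrite -(pmulr_rgt0 _ T0); apply: lt_le_trans Ta.
  by rewrite addr_gt0 // (mulr_gt0 _ c0) ?mulr_gt0.
exists a, (c - a); split=> //.
- have -> : c - a = c * (1 - nu) + c ^+ 2 / 8 by rewrite /a; ring.
  by rewrite (addr_ge0 (mulr_ge0 (ltW c0) _)) ?(divr_ge0 (sqr_ge0 _)) ?subr_ge0 // ltW.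
- have -> : (1 - nu) * expR a + nu * expR (- (c - a)) = expR a * (1 - nu + nu * expR (- c)).
    by rewrite opprB (expRD a (- c)); ring.
  apply: (@le_trans _ _ (expR a * expR (c ^+ 2 / 8 - nu * c))).
    by rewrite ler_wpM2l ?expR_ge0 // hoeffding_bernoulli ?(ltW nu0) // ltW.
  by rewrite -expRD (_ : a + _ = 0) ?expR0 // /a; ring.
- have -> : (s * n * (1 - nu) + w) * a = T * a - nu * s * n * a by rewrite /T; ring.
  by move: Ta; lra.
Qed.

(** * The binomial distribution at its mean *)

Section BinomialAtMean.
Variables (k q : nat).
Local Notation N := (k + q)%N.
Local Open Scope nat_scope.

(* N ^ N times the probability of i successes for the binomial distribution with
   parameters N and k / N. *)
Definition bterm (i : nat) : nat := 'C(N, i) * q ^ (N - i) * k ^ i.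

Lemma btermS i : i < N -> bterm i.+1 * (i.+1 * q) = bterm i * ((N - i) * k).
Proof.
move=> iN; rewrite /bterm (_ : N - i = (N - i.+1).+1); last by lia.
rewrite !expnS; have := mul_bin_left N i.
set a := 'C(N, i.+1); set b := 'C(N, i) => h.
have {}h : a * i.+1 = b * (N - i) by rewrite mulnC h mulnC.
rewrite (_ : (N - i.+1).+1 = N - i); last by lia.
transitivity (a * i.+1 * (q * q ^ (N - i.+1) * (k * k ^ i))); first by lia.
by rewrite h; lia.
Qed.

Lemma bterm_gt i : N < i -> bterm i = 0.
Proof. by move=> h; rewrite /bterm bin_small. Qed.

Hypothesis (k_gt0 : 0 < k) (q_gt0 : 0 < q).

(** Induction outwards from the mean. With l = i + 1, comparing the ratios of neighbouring terms on
    the two sides amounts to k^2 (q^2 - l^2) <= q^2 ((k + 1)^2 - l^2), and k^2 <= (k + 1)^2 - l^2 is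
    the hypothesis l^2 <= 2 k + 1. *)
Lemma bterm_reflect i :
  i <= k -> i ^ 2 <= 2 * k + 1 -> bterm (k + i.+1) <= bterm (k - i).
Proof.
elim: i => [_ _|i IH ik sq].
  rewrite subn0 addn1; have := @btermS k; rewrite addKn => h.
  have {}h := h ltac:(lia).
  rewrite -(@leq_pmul2r (k.+1 * q)) ?muln_gt0 // h leq_mul2l; apply/orP; right.
  by rewrite mulnC leq_mul2r; lia.
have {}IH := IH (ltnW ik) ltac:(nia).
have [le|lt] := leqP q i.+1; first by rewrite bterm_gt //; lia.
have h1 := @btermS (k + i.+1) ltac:(lia).
have h2 := @btermS (k - i.+1) ltac:(lia).
move: h1 h2 IH.
rewrite (_ : (k + i.+1).+1 = k + i.+2); last by lia.
rewrite (_ : (k - i.+1).+1 = k - i); last by lia.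
rewrite (_ : k + q - (k + i.+1) = q - i.+1); last by lia.
rewrite (_ : k + q - (k - i.+1) = q + i.+1); last by lia.
set b2 := bterm (k + i.+2); set b1 := bterm (k + i.+1).
set c1 := bterm (k - i); set c2 := bterm (k - i.+1) => h1 h2 IH.
rewrite -(@leq_pmul2r ((k + i.+2) * q * ((k - i) * q))); last first.
  by rewrite !muln_gt0 q_gt0 !andbT; lia.
rewrite mulnA h1.
apply: (@leq_trans (c1 * ((q - i.+1) * k) * ((k - i) * q))).
  by apply: leq_mul => //; apply: leq_mul.
rewrite (_ : _ * _ * _ = c1 * ((k - i) * q) * ((q - i.+1) * k)); last by lia.
rewrite h2 -mulnA leq_mul2l; apply/orP; right.
(* Writing k = i + 1 + u and q = i + 2 + v removes the truncated subtractions. *)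
move: ik lt sq => /subnKC <- /subnKC <-.
set u := k - _; set v := q - _.
rewrite (_ : i.+1 + u - i = u.+1); last by lia.
rewrite (_ : i.+2 + v - i.+1 = v.+1); last by lia.
move=> sq.
have {}sq : i.+1 ^ 2 <= 2 * (i.+1 + u) + 1 by [].
set l := i.+1 in sq *.
have -> : (i.+2 + v + l) * (l + u) * (v.+1 * (l + u)) = (l + u) ^ 2 * ((i.+2 + v) ^ 2 - l ^ 2).
  rewrite subn_sqr (_ : i.+2 + v - l = v.+1); last by rewrite /l; lia.
  by rewrite -mulnn; move: (i.+2 + v + l) (l + u) => x y; lia.
have -> : (l + u + i.+2) * (i.+2 + v) * (u.+1 * (i.+2 + v)) =
    (i.+2 + v) ^ 2 * ((l + u).+1 ^ 2 - l ^ 2).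
  rewrite subn_sqr (_ : (l + u).+1 - l = u.+1); last by lia.
  rewrite (_ : (l + u).+1 + l = l + u + i.+2); last by rewrite /l; lia.
  by rewrite -mulnn; move: (i.+2 + v) (l + u + i.+2) => x y; lia.
set Q := i.+2 + v; set K := l + u.
have h3 : K ^ 2 <= K.+1 ^ 2 - l ^ 2.
  have aux a b : b ^ 2 <= 2 * a + 1 -> a ^ 2 <= a.+1 ^ 2 - b ^ 2.
    by rewrite -[a.+1]addn1 sqrnD; lia.
  exact: aux.
by rewrite mulnC leq_mul // leq_subr.
Qed.

(** Above the mean the step from offset t to t + 1 multiplies a term by at most k / (k + t + 2). The
    product of the inverse factors 1 + (j + 2) / k over j < t is at least 1 plus their sum, that is
    1 + t (t + 3) / (2 k). *)
Lemma bterm_decay i t :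
  bterm (k + i.+1 + t) * (2 * k + t * (t + 3)) <= 2 * k * bterm (k + i.+1).
Proof.
elim: t => [|t IH]; first by rewrite !addn0 mulnC leq_mul2r; lia.
have [le|lt] := leqP N (k + i.+1 + t); first by rewrite bterm_gt //; lia.
have := @btermS (k + i.+1 + t) lt; rewrite -addnS.
set b1 := bterm (k + i.+1 + t.+1); set b0 := bterm (k + i.+1 + t) in IH *.
set b := bterm _ in IH * => h.
have {}h : b1 * (k + t.+2) <= b0 * k.
  rewrite -(@leq_pmul2r q) //.
  apply: (@leq_trans (b1 * ((k + i.+1 + t.+1) * q))).
    by rewrite -mulnA leq_mul2l leq_mul2r; apply/orP; right; apply/orP; right; lia.
  rewrite h -mulnA leq_mul2l; apply/orP; right; rewrite mulnC leq_mul2l; lia.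
rewrite -(@leq_pmul2r k) //.
apply: (@leq_trans (b1 * (k + t.+2) * (2 * k + t * (t + 3)))).
  by rewrite -!mulnA leq_mul2l; apply/orP; right; nia.
apply: (@leq_trans (b0 * k * (2 * k + t * (t + 3)))); first by rewrite leq_mul2r h orbT.
by rewrite mulnAC leq_mul2r IH orbT.
Qed.

Lemma sum_bterm : \sum_(0 <= i < N.+1) bterm i = N ^ N.
Proof.
rewrite big_mkord addnC expnDn; apply: eq_bigr => i _.
by rewrite /bterm addnC mulnA.
Qed.

(* With m the ceiling of sqrt k, the first m terms above k are dominated by their
   reflections, and every later term is at most 2/3 of the one m places before it. *)
Lemma bterm_quarter : N ^ N <= 4 * \sum_(0 <= i < k.+1) bterm i.
Proof.
have exm : exists m, k <= m ^ 2 by exists k; rewrite -mulnn leq_pmulr.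
case: (ex_minnP exm) => m km minm.
have m_gt0 : 0 < m by case: m km {minm} => //; lia.
have m1 : m.-1 ^ 2 < k by rewrite ltnNge; apply/negP => /minm; lia.
have mk : m <= k.+1 by nia.
set P := \sum_(0 <= i < k.+1) bterm i.
(* The range goes beyond N, where [bterm] vanishes, so that N terms remain once the first m are
   split off. *)
pose S := \sum_(0 <= i < m + N) bterm (k + i.+1).
have tot : N ^ N <= P + S.
  rewrite -sum_bterm /P /S.
  rewrite (_ : \sum_(0 <= i < m + N) bterm (k + i.+1) =
      \sum_(k.+1 <= i < k.+1 + (m + N)) bterm i).
    by rewrite -(@big_cat_nat _ _ _ k.+1) //= ?leq_addr // 
       [X in _ <= X](@big_cat_nat _ _ _ N.+1) //= ?leq_addr //; lia.
  have := big_addn 0 (k.+1 + (m + N)) k.+1 xpredT bterm.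
  rewrite add0n addKn => ->; apply: eq_bigr => i _.
  by congr bterm; lia.
(* This yields S <= 3 P, hence a total of at most 4 P. *)
have S3 : 3 * S <= 3 * P + 2 * S.
  rewrite {1}/S (@big_cat_nat _ _ _ m) ?leq_addr //= mulnDr leq_add //.
    rewrite leq_mul2l /=.
    apply: (@leq_trans (\sum_(0 <= i < m) bterm (k - i))).
      rewrite !big_mkord; apply: leq_sum => i _; apply: bterm_reflect; have := ltn_ord i; nia.
    rewrite /P [X in _ <= X]big_nat_rev /= add0n [X in _ <= X](@big_cat_nat _ _ _ m) //=.
    by rewrite (eq_bigr (fun i => bterm (k - i))) ?leq_addr // => i _; congr bterm; lia.
  have := big_addn 0 (m + N) m xpredT (fun i => bterm (k + i.+1)).
  rewrite add0n addKn => ->.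
  apply: (@leq_trans (2 * \sum_(0 <= i < N) bterm (k + i.+1))).
    rewrite !big_distrr /=; apply: leq_sum => i _.
    have h := @bterm_decay i m.
    rewrite -(@leq_pmul2l k) //.
    rewrite (_ : k + (i + m).+1 = k + i.+1 + m); last by lia.
    rewrite [X in _ <= X]mulnA [k * 2]mulnC; apply: leq_trans h.
    by rewrite mulnA mulnC leq_mul2l; apply/orP; right; nia.
  by rewrite leq_mul2l /= /S (addnC m) [X in _ <= X](@big_cat_nat _ _ _ N) ?leq_addr.
lia.
Qed.
End BinomialAtMean.

Lemma binomial_mean_quarter (R : realFieldType) (N k : nat) (r := k%:R / N%:R : R) :
  (k < N)%N ->
  1 / 4 <= \sum_(0 <= i < k.+1) 'C(N, i)%:R * (1 - r) ^+ (N - i) * r ^+ i.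
Proof.
move=> kN; have N0 : (N%:R : R) != 0 by rewrite pnatr_eq0; lia.
(* For k = 0 the distribution is concentrated at 0 and the sum is 1. *)
have [k0|k0] := posnP k.
  by rewrite /r k0 big_nat1 subn0 bin0 expr0 mulr1 mul1r mulr0n mul0r subr0 expr1n; lra.
have /(@bterm_quarter k (N - k) k0) : (0 < N - k)%N by lia.
rewrite subnKC ?(ltnW kN) // => h.
have {h} : ((N ^ N)%:R : R) <= 4 * \sum_(0 <= i < k.+1) (bterm k (N - k) i)%:R.
  by rewrite -natr_sum -natrM ler_nat.
have NN : 0 < (N ^ N)%:R :> R by rewrite ltr0n expn_gt0; lia.
have -> : \sum_(0 <= i < k.+1) (bterm k (N - k) i)%:R =
   (N ^ N)%:R * \sum_(0 <= i < k.+1) 'C(N, i)%:R * (1 - r) ^+ (N - i) * r ^+ i.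
  rewrite big_distrr /=; apply: eq_big_nat => i ik.
  rewrite /bterm subnKC ?(ltnW kN) // !natrM !natrX.
  have iN : (i <= N)%N by lia.
  have -> : 1 - r = (N - k)%:R / N%:R by rewrite natrB ?(ltnW kN) // mulrBl divff.
  have -> : N%:R ^+ N = N%:R ^+ (N - i) * N%:R ^+ i :> R by rewrite -exprD subnK.
  rewrite /r !expr_div_n; move: ('C(N, i)%:R : R) => c.
  by field; rewrite !expf_eq0 (negPf N0) !andbF.
rewrite mulrCA => h.
have := h; rewrite -{1}[(N ^ N)%:R]mulr1 ler_pM2l // => ?; lra.
Qed.

(** * Weights on sets of bad sites *)

(** The permutation matches the enumeration of A with that of B, and the enumeration of the
    complement of A with that of the complement of B. *)
Lemma perm_of_card_eq (T : finType) (A B : {set T}) :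
  #|A| = #|B| -> exists g : {perm T}, forall t, (g t \in B) = (t \in A).
Proof.
move=> AB.
have [x0|T0] := pickP T; last by exists 1%g => t; have := T0 t.
move=> _.
pose h (C D : {set T}) t := nth x0 (enum D) (index t (enum C)).
have hD (C D : {set T}) t : #|C| = #|D| -> t \in C -> h C D t \in D.
  by move=> CD tC; rewrite /h -mem_enum mem_nth // -cardE -CD cardE index_mem mem_enum.
have hI (C D : {set T}) t u : #|C| = #|D| -> t \in C -> u \in C -> h C D t = h C D u -> t = u.
  move=> CD tC uC /eqP; rewrite nth_uniq ?enum_uniq // -?cardE -?CD ?cardE ?index_mem ?mem_enum //.
  by move=> /eqP/(congr1 (nth x0 (enum C))); rewrite !nth_index ?mem_enum.
have AB' : #|~: A| = #|~: B| by apply: (@addnI #|A|); rewrite cardsC AB cardsC.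
pose f t := if t \in A then h A B t else h (~: A) (~: B) t.
have fB t : (f t \in B) = (t \in A).
  rewrite /f; case: ifPn => tA; first by rewrite hD.
  by have := hD _ _ t AB'; rewrite !inE tA => /(_ isT)/negbTE.
have f_inj : injective f.
  move=> t u ftu; have : (t \in A) = (u \in A) by rewrite -!fB ftu.
  move: ftu; rewrite /f; case: ifPn => tA; case: ifPn => uA // + _; first exact: hI.
  by apply: hI AB' _ _; rewrite inE.
by exists (perm f_inj) => t; rewrite permE.
Qed.

Lemma perm_of_card_eq_fix (T : finType) (A B : {set T}) (t0 : T) :
  #|A| = #|B| -> t0 \notin A -> t0 \notin B ->
  exists2 g : {perm T}, g t0 = t0 & forall t, (g t \in B) = (t \in A).
Proof.
move=> /perm_of_card_eq[g gP] tA tB.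
(* Both [g t0] and [t0] lie outside B, so exchanging them keeps B stable. *)
exists (g * tperm (g t0) t0)%g => [|t]; first by rewrite permM tpermL.
rewrite permM -gP; case: tpermP => // [->|->]; last by rewrite gP (negPf tA) (negPf tB).
by rewrite gP (negPf tA) (negPf tB).
Qed.

Section SetWeights.
Variables (R : realType) (N : nat).
Local Notation I := 'I_N.+1.
Implicit Types (al be : I -> R) (w : {set I} -> R) (x S : {set I}).

(* x is the set of bad sites; al l and be l weigh a good and a bad site l. *)
Definition site_prod al be x : R := \prod_l (if l \in x then be l else al l).

Definition site_mean al be w : R := \sum_x site_prod al be x * w x.

Definition exchangeable w : Prop := forall (g : {perm I}) x, w (g @: x) = w x.

Lemma site_prod_perm al be (g : {perm I}) x :
  site_prod (al \o g) (be \o g) x = site_prod al be (g @: x).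
Proof.
rewrite /site_prod [RHS](reindex_inj (@perm_inj _ g)) /=.
by apply: eq_bigr => l _; rewrite mem_imset //; exact: perm_inj.
Qed.

Lemma site_mean_perm al be w (g : {perm I}) :
  exchangeable w -> site_mean (al \o g) (be \o g) w = site_mean al be w.
Proof.
move=> wx; rewrite /site_mean [RHS](reindex_inj (imset_inj (@perm_inj _ g))) /=.
by apply: eq_bigr => x _; rewrite site_prod_perm wx.
Qed.

Lemma eq_site_mean al be al' be' w :
  al =1 al' -> be =1 be' -> site_mean al be w = site_mean al' be' w.
Proof.
by move=> e1 e2; apply: eq_bigr => x _; congr (_ * _); apply: eq_bigr => l _; rewrite e1 e2.
Qed.

Lemma site_prod_ge0 al be x :
  (forall l, 0 <= al l) -> (forall l, 0 <= be l) -> 0 <= site_prod al be x.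
Proof. by move=> h1 h2; apply: prodr_ge0 => l _; case: ifP. Qed.

Variable nu : R.

(* In terms of the target projector P and Q = 1 - P, the factors of test_op are
   Omega = P + (1 - nu) Q, Omegabar = nu Q, and a P + b Q on the last site. *)
Definition test_al i (a : R) (l : I) : R :=
  if (l < N - i)%N then 1 else if (l < N)%N then 0 else a.
Definition test_be i (b : R) (l : I) : R :=
  if (l < N - i)%N then 1 - nu else if (l < N)%N then nu else b.

Definition test_mean k (a b : R) w : R :=
  \sum_(0 <= i < k.+1) 'C(N, i)%:R * site_mean (test_al i a) (test_be i b) w.

(** Isolating the last site shows that the product is linear in (a, b). *)
Lemma site_prod_test i a b x :
  site_prod (test_al i a) (test_be i b) x =
  site_prod (test_al i 1) (test_be i 1) (x :\ ord_max) * (if ord_max \in x then b else a).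
Proof.
rewrite /site_prod !big_ord_recr /= !inE eqxx /= /test_al /test_be !ltnn !ltnNge leq_subr /= mulr1.
congr (_ * _); apply: eq_bigr => l _.
have -> : (widen_ord (leqnSn N) l \in x :\ ord_max) = (widen_ord (leqnSn N) l \in x).
  by rewrite !inE -val_eqE /= ltn_eqF.
by rewrite /= ltn_ord.
Qed.

Lemma test_meanD k a b a' b' w :
  test_mean k (a + a') (b + b') w = test_mean k a b w + test_mean k a' b' w.
Proof.
rewrite /test_mean -big_split /=; apply: eq_bigr => i _; rewrite -mulrDr; congr (_ * _).
rewrite /site_mean -big_split /=; apply: eq_bigr => x _; rewrite -mulrDl; congr (_ * _).
rewrite (site_prod_test i (a + a')) (site_prod_test i a) (site_prod_test i a') -mulrDr.
by case: ifP.
Qed.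

(* When every site is tested, S being the set of failures. *)
Definition fail_al S (l : I) : R := if l \in S then 0 else 1.
Definition fail_be S (l : I) : R := if l \in S then nu else 1 - nu.

(* When all sites but l0 are tested. *)
Definition fail_al_at l0 a S (l : I) : R := if l == l0 then a else fail_al S l.
Definition fail_be_at l0 b S (l : I) : R := if l == l0 then b else fail_be S l.

(** The coefficient C(N, i) counts the sets of i failures among the first N sites. By
    exchangeability each has the same mean as the set S0 of the last i of these sites, which is the
    one that [test_op] uses. *)
Lemma test_mean_sets k a b w : exchangeable w -> (k <= N)%N ->
  test_mean k a b w = \sum_(S : {set I} | (ord_max \notin S) && (#|S| <= k)%N)
     site_mean (fail_al_at ord_max a S) (fail_be_at ord_max b S) w.
Proof.
move=> wx kN.
pose F S := site_mean (fail_al_at ord_max a S) (fail_be_at ord_max b S) w.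
rewrite /test_mean big_mkord.
(* Grouping by cardinality; [inord] is faithful here because the cardinalities are at most k. *)
rewrite (partition_big (fun S : {set I} => inord #|S| : 'I_k.+1) xpredT) //=.
apply: eq_bigr => i _.
have ik : (i <= k)%N by rewrite -ltnS.
pose S0 : {set I} := [set l : I | (N - i <= l < N)%N].
have m0 : ord_max \notin S0 by rewrite inE /= ltnn andbF.
have cS0 : #|S0| = i.
  have -> : S0 = [set inord (N - i + j) | j : 'I_i].
    apply/setP => l; rewrite inE; apply/idP/imsetP => [/andP[h1 h2]|[j _ ->]].
      have h3 : (l - (N - i) < i)%N by lia.
      by exists (Ordinal h3) => //=; apply/val_inj; rewrite /= inordK; lia.
    by have := ltn_ord j => h; rewrite inordK; lia.
  rewrite card_imset ?card_ord // => j j' /(congr1 val) /=.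
  have := ltn_ord j; have := ltn_ord j' => h1 h2.
  by rewrite !inordK; [move=> h; apply/val_inj => /=; lia|lia|lia].
have eqS0 : site_mean (test_al i a) (test_be i b) w = F S0.
  have mP (l : I) : (l == ord_max) = ~~ (l < N)%N.
    by apply/eqP/idP => [->|h]; rewrite ?ltnn //; apply/val_inj => /=; have := ltn_ord l; lia.
  apply: eq_site_mean => l; rewrite /fail_al_at /fail_be_at /fail_al /fail_be /test_al /test_be mP inE.
    by have [h1|h1] := ltnP l (N - i); have [h2|h2] := ltnP l N => //=; lia.
  by have [h1|h1] := ltnP l (N - i); have [h2|h2] := ltnP l N => //=; lia.
rewrite (eq_bigl (fun S =>
  S \in [set S : {set I} | S \subset ~: [set ord_max] & #|S| == i])); last first.
  move=> S; rewrite inE finset.subsetC finset.sub1set inE; case: (_ \notin S) => //=.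
  apply/andP/eqP => [[h /eqP <-]|->]; first by rewrite inordK.
  by rewrite ik; split=> //; apply/eqP/val_inj; rewrite /= inordK.
rewrite (eq_bigr (fun=> F S0)); last first.
  move=> S; rewrite inE finset.subsetC finset.sub1set inE => /andP[mS /eqP cS].
  have [g gm gS] := @perm_of_card_eq_fix _ S0 S ord_max (etrans cS0 (esym cS)) m0 mS.
  rewrite -(site_mean_perm _ _ g wx); apply: eq_site_mean => l /=.
    by rewrite /fail_al_at /fail_al gS -{1}gm (inj_eq perm_inj).
  by rewrite /fail_be_at /fail_be gS -{1}gm (inj_eq perm_inj).
rewrite big_const iter_addr_0 eqS0 -[RHS]mulr_natl; congr (_%:R * _).
by rewrite cards_draws cardsC1 card_ord.
Qed.

(* The probability that S is the set of failures, given the set x of bad sites. *)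
Definition fail_prod S x : R := site_prod (fail_al S) (fail_be S) x.

Lemma site_prodD1 al be x l0 :
  site_prod al be x =
  (if l0 \in x then be l0 else al l0) * \prod_(l | l != l0) (if l \in x then be l else al l).
Proof. by rewrite /site_prod (bigD1 l0). Qed.

Lemma fail_at_prod l0 (a b : R) S x :
  site_prod (fail_al_at l0 a S) (fail_be_at l0 b S) x =
  (if l0 \in x then b else a) * \prod_(l | l != l0) (if l \in x then fail_be S l else fail_al S l).
Proof.
rewrite (site_prodD1 _ _ _ l0) /fail_al_at /fail_be_at eqxx; congr (_ * _).
by apply: eq_bigr => l /negbTE ->.
Qed.

Lemma bad_mean_sym l0 l1 k w : exchangeable w ->
  \sum_(S : {set I} | (l0 \notin S) && (#|S| <= k)%N)
     site_mean (fail_al_at l0 0 S) (fail_be_at l0 1 S) w =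
  \sum_(S : {set I} | (l1 \notin S) && (#|S| <= k)%N)
     site_mean (fail_al_at l1 0 S) (fail_be_at l1 1 S) w.
Proof.
move=> wx; pose g := tperm l0 l1.
have gE l : (g l == l1) = (l == l0) by rewrite -[in RHS](inj_eq (@perm_inj _ g)) tpermL.
rewrite [RHS](reindex_inj (imset_inj (@perm_inj _ g))) /=.
apply: eq_big => S.
  rewrite card_imset; last exact: perm_inj.
  by rewrite -(mem_imset S l0 (@perm_inj _ g)) tpermL.
move=> _; rewrite -[RHS](site_mean_perm _ _ g wx); apply: eq_site_mean => l /=.
  rewrite /fail_al_at /fail_al mem_imset; last exact: perm_inj.
  by rewrite gE.
rewrite /fail_be_at /fail_be mem_imset; last exact: perm_inj.
by rewrite gE.
Qed.

(** By [bad_mean_sym] the untested site may be any l0, so the factor N + 1 becomes a sum over l0. A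
    bad site passes with probability 1 - nu, so that factor replaces an untested bad l0 by a bad l0
    that is tested and passes; summing over l0 then counts the set x \ S. *)
Lemma test_mean_bad k w : exchangeable w -> (k <= N)%N ->
  (1 - nu) * (N.+1%:R * test_mean k 0 1 w) =
  \sum_(S : {set I} | (#|S| <= k)%N) \sum_x #|x :\: S|%:R * (fail_prod S x * w x).
Proof.
move=> wx kN; rewrite test_mean_sets //.
pose F l0 := \sum_(S : {set I} | (l0 \notin S) && (#|S| <= k)%N)
     site_mean (fail_al_at l0 0 S) (fail_be_at l0 1 S) w.
rewrite -[\sum_(S | _) _]/(F ord_max).
have -> : N.+1%:R * F ord_max = \sum_l0 F l0.
  rewrite (eq_bigr (fun=> F ord_max)); last by move=> l _; exact: bad_mean_sym.
  by rewrite big_const iter_addr_0 card_ord mulr_natl.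
rewrite big_distrr /=.
under eq_bigr => l0 _ do rewrite /F big_mkcondl big_distrr /=.
rewrite exchange_big /=; apply: eq_bigr => S _.
transitivity (\sum_l0 \sum_(x : {set I}) ((l0 \notin S) && (l0 \in x))%:R * (fail_prod S x * w x)).
  apply: eq_bigr => l0 _; case: ifPn => lS; last first.
    by rewrite mulr0 big1 // => x _; rewrite mul0r.
  rewrite /site_mean big_distrr /=; apply: eq_bigr => x _.
  rewrite !mulrA; congr (_ * _).
  rewrite fail_at_prod /fail_prod (site_prodD1 _ _ _ l0) /fail_be (negbTE lS).
  case: (l0 \in x); by rewrite ?mul0r ?mul1r ?mulr0.
rewrite exchange_big /=; apply: eq_bigr => x _.
rewrite -big_distrl /=; congr (_ * _).
rewrite -natr_sum -sum1_card [in RHS]big_mkcond /=; congr (_%:R).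
by apply: eq_bigr => l _; rewrite inE; case: ifP.
Qed.

Definition iid_weight (r : R) x : R := site_prod (fun=> 1 - r) (fun=> r) x.

Lemma iid_weight_ge0 r x : 0 <= r <= 1 -> 0 <= iid_weight r x.
Proof. by move=> /andP[r0 r1]; apply: site_prod_ge0 => _ //; rewrite subr_ge0. Qed.

Lemma site_mean_iid al be r : site_mean al be (iid_weight r) = \prod_l (be l * r + al l * (1 - r)).
Proof.
rewrite bigA_distr /=; apply: eq_bigr => x _; rewrite /site_prod -big_split /=.
by apply: eq_bigr => l _; case: ifP.
Qed.

Lemma sum_iid_weight r : \sum_x iid_weight r x = 1.
Proof.
transitivity (site_mean (fun=> 1) (fun=> 1) (iid_weight r)).
  by apply: eq_bigr => x _; rewrite /site_prod big1 ?mul1r // => l _; case: ifP.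
by rewrite site_mean_iid big1 // => l _; rewrite !mul1r addrC subrK.
Qed.

Lemma exchangeable_iid r : exchangeable (iid_weight r).
Proof. by move=> g x; rewrite /iid_weight -site_prod_perm. Qed.

(** Under independence each tested site fails with probability nu r, and the last site splits off as
    a factor. *)
Lemma test_mean_iid k a b r : (k <= N)%N ->
  test_mean k a b (iid_weight r) =
  (\sum_(0 <= i < k.+1) 'C(N, i)%:R * (1 - nu * r) ^+ (N - i) * (nu * r) ^+ i) *
  (b * r + a * (1 - r)).
Proof.
move=> kN; rewrite /test_mean big_distrl /=; apply: eq_big_nat => i ik.
rewrite -!mulrA; congr (_ * _).
rewrite site_mean_iid big_ord_recr /= {2}/test_be {2}/test_al.
rewrite !ltnn !ltnNge leq_subr /= mulrA; congr (_ * _).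
rewrite (eq_bigr (fun l : 'I_N => if (l < N - i)%N then 1 - nu * r else nu * r)); last first.
  move=> l _; rewrite /test_be /test_al /= ltn_ord; case: ifP => _; ring.
rewrite -(big_mkord xpredT (fun l => if (l < N - i)%N then 1 - nu * r else nu * r)).
rewrite (@big_cat_nat _ _ _ (N - i)) ?leq_subr //=; congr (_ * _).
  rewrite (@eq_big_nat _ _ _ 0 (N - i) _ (fun=> 1 - nu * r)); last by move=> l /andP[_ ->].
  by rewrite prodr_const_nat subn0.
rewrite (@eq_big_nat _ _ _ (N - i) N _ (fun=> nu * r)); last first.
  by move=> l /andP[h _]; rewrite ltnNge h.
by rewrite prodr_const_nat; congr (_ ^+ _); lia.
Qed.

Hypothesis nu01 : 0 <= nu <= 1.

Lemma fail_prod_ge0 S x : 0 <= fail_prod S x.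
Proof.
apply: site_prod_ge0 => l; rewrite /fail_al /fail_be; case: ifP => // _;
  by move: nu01 => /andP[]; lra.
Qed.

(** At most k failures among all N + 1 sites implies at most k among the first N. Testing the last
    site as well splits the outcome S into S and S with the last site added. *)
Lemma fail_mean_le_test k w : (forall x, 0 <= w x) -> exchangeable w -> (k <= N)%N ->
  \sum_(S : {set I} | (#|S| <= k)%N) \sum_x fail_prod S x * w x <= test_mean k 1 1 w.
Proof.
move=> w0 wx kN; rewrite test_mean_sets //.
pose W S := \sum_x fail_prod S x * w x.
have W0 S : 0 <= W S by apply: sumr_ge0 => x _; rewrite mulr_ge0 ?fail_prod_ge0.
have E S : ord_max \notin S -> site_mean (fail_al_at ord_max 1 S) (fail_be_at ord_max 1 S) w
    = W S + W (ord_max |: S).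
  move=> mS; rewrite /W -big_split /=; apply: eq_bigr => x _; rewrite -mulrDl; congr (_ * _).
  rewrite fail_at_prod /fail_prod (site_prodD1 _ _ _ ord_max).
  rewrite [in X in _ + X](site_prodD1 _ _ _ ord_max).
  rewrite /fail_be /fail_al !inE eqxx (negbTE mS) /=.
  have -> : \prod_(l | l != ord_max)
    (if l \in x then (if l \in ord_max |: S then nu else 1 - nu)
     else if l \in ord_max |: S then 0 else 1)
    = \prod_(l | l != ord_max)
    (if l \in x then (if l \in S then nu else 1 - nu) else if l \in S then 0 else 1).
    by apply: eq_bigr => l /negbTE lm; rewrite !inE lm.
  by rewrite -mulrDl; congr (_ * _); case: ifP => _; rewrite ?subrK ?addr0.
rewrite [X in _ <= X](eq_bigr (fun S => W S + W (ord_max |: S))); last by move=> S /andP[/E].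
rewrite big_split /= (bigID (fun S : {set I} => ord_max \notin S)) /=.
rewrite lerD //.
  by rewrite le_eqVlt (eq_bigl _ _ (fun S => andbC _ _)) eqxx.
(* Removing the last site lowers the cardinality by one, so the bound k still holds. *)
rewrite (reindex_onto (fun S => ord_max |: S) (fun S => S :\ ord_max)) /=; last first.
  by move=> S /andP[_ /negPn mS]; rewrite finset.setD1K.
rewrite [X in X <= _]big_mkcond [X in _ <= X]big_mkcond /=; apply: ler_sum => S _.
case: ifP => [/andP[/andP[h1 _] /eqP h3]|_]; last by case: ifP.
have mS : ord_max \notin S by rewrite -h3 !inE eqxx.
by rewrite mS /=; move: h1; rewrite cardsU1 mS add1n => /ltnW ->.
Qed.

(** For fixed x the sum over S factorises over the sites: a good site contributes 1, a bad one (1 -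
    nu) e^a + nu e^-b. *)
Lemma fail_mean_exp (a b : R) w : (forall x, 0 <= w x) -> \sum_x w x = 1 ->
  (1 - nu) * expR a + nu * expR (- b) <= 1 ->
  \sum_S \sum_x expR (a * #|x :\: S|%:R - b * #|S|%:R) * (fail_prod S x * w x) <= 1.
Proof.
move=> w0 w1 ab; rewrite exchange_big /= -[leRHS]w1; apply: ler_sum => x _.
under eq_bigr => S _ do rewrite mulrA.
rewrite -big_distrl /= -[leRHS]mul1r ler_wpM2r //.
have E S : expR (a * #|x :\: S|%:R - b * #|S|%:R) * fail_prod S x =
  \prod_l (if l \in S then (if l \in x then nu * expR (- b) else 0)
           else (if l \in x then (1 - nu) * expR a else 1)).
  rewrite expRD -mulNr 2!expRM_natr -(prodr_const (mem (x :\: S))) -(prodr_const (mem S)).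
  rewrite 2![\prod_(l in _) _]big_mkcond -2!big_split /=.
  apply: eq_bigr => l _; rewrite /fail_be /fail_al inE.
  by case: (l \in S); case: (l \in x) => /=; rewrite ?mul1r ?mulr0 ?mulr1 // mulrC.
have -> : \sum_S expR (a * #|x :\: S|%:R - b * #|S|%:R) * fail_prod S x =
    \prod_l ((if l \in x then nu * expR (- b) else 0) +
             (if l \in x then (1 - nu) * expR a else 1)).
  by rewrite bigA_distr; apply: eq_bigr => S _; exact: E.
apply: prodr_ile1 => l _; move: nu01 => /andP[n0 n1].
case: ifP => _; last by rewrite add0r lexx ler01.
by rewrite addrC ab addr_ge0 // mulr_ge0 ?expR_ge0 // subr_ge0.
Qed.

(** Put y = a |x \ S| - b |S|. If |S| <= k, then a |x \ S| <= y + b k <= L - 1 + b k + e^-L e^y.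
    Averaging with [fail_mean_exp] gives (L - 1 + b k) p + e^-L, and e^-L <= p. *)
Lemma bad_mean_le k (a b L : R) w :
  (forall x, 0 <= w x) -> \sum_x w x = 1 -> exchangeable w -> (k <= N)%N ->
  0 <= b -> 1 <= L -> (1 - nu) * expR a + nu * expR (- b) <= 1 ->
  expR (- L) <= test_mean k 1 1 w ->
  a * ((1 - nu) * (N.+1%:R * test_mean k 0 1 w)) <= (L + b * k%:R) * test_mean k 1 1 w.
Proof.
move=> w0 w1 wx kN b0 L1 ab pL; rewrite test_mean_bad //.
set p := test_mean _ _ _ _ in pL *.
have h1 := @fail_mean_le_test k w w0 wx kN.
have h2 := @fail_mean_exp a b w w0 w1 ab.
set h := \sum_(S : {set I} | _) _ in h1.
have W0 S x : 0 <= fail_prod S x * w x by rewrite mulr_ge0 ?fail_prod_ge0.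
apply: (@le_trans _ _ ((L - 1 + b * k%:R) * h + expR (- L) *
   \sum_S \sum_x expR (a * #|x :\: S|%:R - b * #|S|%:R) * (fail_prod S x * w x))).
  (* The exponential terms with |S| > k are nonnegative and are dropped. *)
  rewrite [in leRHS](bigID (fun S : {set I} => (#|S| <= k)%N)) /= mulrDr addrA.
  rewrite ler_wpDr //.
    rewrite mulr_ge0 ?expR_ge0 //; apply: sumr_ge0 => S _; apply: sumr_ge0 => x _.
    by rewrite mulr_ge0 ?expR_ge0.
  rewrite !big_distrr /= -big_split /=; apply: ler_sum => S Sk.
  rewrite !big_distrr /= -big_split /=; apply: ler_sum => x _.
  move: (W0 S x); set W := _ * w x => W_ge0.
  rewrite (mulrA a) (mulrA (expR _)) -mulrDl ler_wpM2r // -expRD.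
  have := expR_ge1Dx (- L + (a * #|x :\: S|%:R - b * #|S|%:R)).
  have : b * #|S|%:R <= b * k%:R by rewrite ler_wpM2l // ler_nat.
  lra.
apply: (@le_trans _ _ ((L - 1 + b * k%:R) * p + p * 1)); last by lra.
rewrite lerD //.
  by rewrite ler_wpM2l // addr_ge0 ?subr_ge0 // mulr_ge0.
rewrite ler_pM ?expR_ge0 //.
by apply: sumr_ge0 => S _; apply: sumr_ge0 => x _; rewrite mulr_ge0 ?expR_ge0.
Qed.

End SetWeights.

(** * Minimising a ratio of linear functionals over a closed part of the simplex *)

Section SimplexMinimum.
Local Open Scope classical_set_scope.

Lemma continuous_row_sum (R : realType) n (c : 'I_n -> R) :
  continuous (fun v : 'rV[R]_n => \sum_i c i * v 0 i).
Proof.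
apply: continuous_big => [|i _ v]; first exact: add_continuous.
by apply: continuousM; [exact: cst_continuous|exact: coord_continuous].
Qed.

(** Functions on X are coded as row vectors. The constraints cut a compact set out of the unit cube,
    and delta > 0 keeps the denominator away from 0, so the ratio is continuous there. The relation
    [e] will express exchangeability. *)
Lemma simplex_ratio_min (R : realType) (X : finType) (e : X -> X -> Prop)
  (p f : X -> R) (delta : R)
  (K := fun w : X -> R => [/\ forall x, 0 <= w x, \sum_x w x = 1,
     forall x y, e x y -> w x = w y & delta <= \sum_x p x * w x]) :
  0 < delta -> (exists w, K w) ->
  exists2 w, K w & forall w', K w' ->
    (\sum_x f x * w x) / (\sum_x p x * w x) <= (\sum_x f x * w' x) / (\sum_x p x * w' x).
Proof.
move=> delta0 [w0 Kw0].
pose n := #|X|.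
pose W (v : 'rV[R]_n) x := v 0 (enum_rank x).
pose V (w : X -> R) : 'rV[R]_n := \row_i w (enum_val i).
have VK w : W (V w) = w by apply/funext => x; rewrite /W mxE enum_rankK.
have linE (c : X -> R) v : \sum_x c x * W v x = \sum_i c (enum_val i) * v 0 i.
  rewrite (reindex (@enum_val X X)) /=; last exact: onW_bij (@enum_val_bij _).
  by apply: eq_bigr => i _; rewrite /W enum_valK.
have contL c : continuous (fun v => \sum_x c x * W v x).
  by under eq_fun do rewrite linE; exact: continuous_row_sum.
have closedL c (A : set R) : closed A -> closed [set v | A (\sum_x c x * W v x)].
  move=> cA; apply: (@preimage_closed _ _ (fun v => \sum_x c x * W v x)) => // v _; exact: contL.
pose B := [set v : 'rV[R]_n | forall i, `[(0:R), 1]%classic (v ord0 i)].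
have cB : compact B.
  exact: (@rV_compact R n (fun=> `[(0 : R), 1]%classic) (fun=> @segment_compact R 0 1)).
(* Each constraint is phrased through linear functionals so that [closedL] applies. *)
pose S1 := [set v : 'rV[R]_n | \sum_x 1 * W v x = 1].
pose S2 := \bigcap_(xy in [set xy : X * X | e xy.1 xy.2])
   [set v : 'rV[R]_n | \sum_x ((x == xy.1)%:R - (x == xy.2)%:R) * W v x = 0].
pose S3 := [set v : 'rV[R]_n | delta <= \sum_x p x * W v x].
have S1c : closed S1 by apply: (closedL (fun=> 1) [set x | x = 1]); exact: closed_eq.
have S2c : closed S2.
  apply: closed_bigI => xy _.
  apply: (closedL (fun x => (x == xy.1)%:R - (x == xy.2)%:R) [set x | x = 0]).
  exact: closed_eq.
have S3c : closed S3 by apply: (closedL p [set x | delta <= x]); exact: closed_ge.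
pose A := B `&` S1 `&` S2 `&` S3.
have cA : compact A by do 3 apply: compact_closedI => //.
have S2E v (x y : X) : \sum_z ((z == x)%:R - (z == y)%:R) * W v z = W v x - W v y.
  under eq_bigr => z _ do rewrite mulrBl.
  have one z0 : \sum_z (z == z0)%:R * W v z = W v z0.
    by rewrite (bigD1 z0) //= eqxx mul1r big1 ?addr0 // => z /negbTE ->; rewrite mul0r.
  by rewrite sumrB !one.
have AK v : A v <-> K (W v).
  split=> [[[[Bv S1v] S2v] S3v]|[h1 h2 h3 h4]].
    split=> //; first by move=> x; have /andP[] := Bv (enum_rank x).
      by rewrite -[RHS]S1v; apply: eq_bigr => x _; rewrite mul1r.
    by move=> x y exy; apply/eqP; rewrite -subr_eq0 -S2E; apply/eqP; exact: (S2v (x, y)).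
  split=> //; split; [split|].
  - move=> i; have -> : v ord0 i = W v (enum_val i) by rewrite /W enum_valK.
    rewrite /= in_itv /= h1 /= -h2 (bigD1 (enum_val i)) //= lerDl.
    by apply: sumr_ge0.
  - by rewrite /S1 /= -[RHS]h2; apply: eq_bigr => x _; rewrite mul1r.
  - by move=> [x y] /= /h3 exy; rewrite S2E exy subrr.
pose F v := (\sum_x f x * W v x) / (\sum_x p x * W v x).
have [||v] := @compact_EVT_min _ R F A _ cA.
- by exists (V w0); apply/AK; rewrite VK.
- apply: continuous_in_subspaceT => v /set_mem[_ S3v].
  have p0 : \sum_x p x * W v x != 0 by rewrite gt_eqF //; exact: lt_le_trans S3v.
  exact: cvgM (contL f v) (cvgV p0 (contL p v)).
move=> /set_mem/AK Kv vmin; exists (W v) => // w' Kw'.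
by have := vmin (V w'); rewrite /F VK; apply; apply/mem_set/AK; rewrite VK.
Qed.

End SimplexMinimum.

(** * Tensor operators *)

Section TensorOperators.
Local Open Scope complex_scope.
Local Open Scope sesquilinear_scope.
Variables (C : numClosedFieldType) (D m : nat).
Local Notation T := {ffun 'I_m -> 'I_D}.
Implicit Types (A B : 'I_m -> 'M[C]_D).

Lemma tbasis_inj : injective (@tbasis D m).
Proof. exact: enum_val_inj. Qed.

Lemma sum_tbasis (V : nmodType) (F : T -> V) :
  \sum_(a < tdim D m) F (tbasis a) = \sum_f F f.
Proof.
rewrite [RHS](reindex (@enum_val T T)) //=.
exact: onW_bij (@enum_val_bij _).
Qed.

Lemma tensopM A B : tensop A *m tensop B = tensop (fun l => A l *m B l).
Proof.
apply/matrixP => a b; rewrite !mxE.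
under eq_bigr => c _ do rewrite !mxE -big_split /=.
rewrite (sum_tbasis (fun c : T =>
  \prod_(l < m) (A l (tbasis a l) (c l) * B l (c l) (tbasis b l)))).
rewrite -(bigA_distr_bigA (fun l j => A l (tbasis a l) j * B l j (tbasis b l))).
by apply: eq_bigr => l _; rewrite mxE.
Qed.

Lemma mxtrace_tensop A : \tr (tensop A) = \prod_l \tr (A l).
Proof.
rewrite /mxtrace bigA_distr_bigA.
rewrite -(sum_tbasis (fun c : T => \prod_(l < m) A l (c l) (c l))).
by apply: eq_bigr => a _; rewrite mxE.
Qed.

Lemma tensop1 : tensop (fun _ : 'I_m => 1%:M : 'M[C]_D) = 1%:M.
Proof.
apply/matrixP => a b; rewrite !mxE; case: (eqVneq a b) => [->|ab].
  by rewrite big1 // => l _; rewrite mxE eqxx.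
have /forallPn[l ll] : ~~ [forall l, tbasis a l == tbasis b l].
  apply: contraNN ab => /forallP h; apply/eqP/tbasis_inj/ffunP => l; exact/eqP/h.
by rewrite (bigD1 l) //= mxE (negbTE ll) mul0r.
Qed.

Lemma tensop_adj A : (tensop A)^t* = tensop (fun l => (A l)^t*).
Proof.
apply/matrixP => a b; rewrite !mxE rmorph_prod.
by apply: eq_bigr => l _; rewrite !mxE.
Qed.

Lemma eq_tensop A B : A =1 B -> tensop A = tensop B.
Proof.
by move=> AB; apply/matrixP => a b; rewrite !mxE; apply: eq_bigr => l _; rewrite AB.
Qed.

(** Expanding the product over sites, x being the set of sites where Q is chosen. *)
Lemma tensop_distr (al be : 'I_m -> C) (P Q : 'M[C]_D) :
  tensop (fun l => al l *: P + be l *: Q) =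
  \sum_(x : {set 'I_m}) (\prod_l (if l \in x then be l else al l)) *:
     tensop (fun l => if l \in x then Q else P).
Proof.
apply/matrixP => a b; rewrite mxE summxE.
under eq_bigr => l _ do rewrite !mxE addrC.
rewrite bigA_distr; apply: eq_bigr => x _; rewrite !mxE -big_split /=.
by apply: eq_bigr => l _; case: ifP.
Qed.

(** A permutation matrix has one nonzero entry in each row and column, so each matrix product
    reduces to a single term. *)
Lemma permop_tensop (g : 'S_m) A :
  permop C D g *m tensop A = tensop (A \o g) *m permop C D g.
Proof.
apply/matrixP => a b; rewrite !mxE.
under eq_bigr => c _ do rewrite !mxE.
under [RHS]eq_bigr => c _ do rewrite !mxE.
rewrite (sum_tbasis (fun c : T =>
  (tbasis a == [ffun l => c (g l)])%:R * \prod_(l < m) A l (c l) (tbasis b l))).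
rewrite (sum_tbasis (fun c : T => \prod_(l < m) (A \o g) l (tbasis a l) (c l) *
   (c == [ffun l => tbasis b (g l)])%:R)).
rewrite (bigD1 [ffun l => tbasis a ((g^-1)%g l)]) //= [X in _ + X]big1 ?addr0; last first.
  move=> c hc; case: eqP => [E|]; last by rewrite mul0r.
  case/eqP: hc; apply/ffunP => l; rewrite !ffunE E ffunE; by rewrite permKV.
rewrite [RHS](bigD1 [ffun l => tbasis b (g l)]) //= [X in _ = _ + X]big1 ?addr0; last first.
  by move=> c /negbTE ->; rewrite mulr0.
rewrite eqxx mulr1.
have -> : tbasis a == [ffun l => [ffun l0 => tbasis a ((g^-1)%g l0)] (g l)].
  by apply/eqP/ffunP => l; rewrite !ffunE permK.
rewrite mul1r (reindex_inj (@perm_inj _ g)) /=.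
by apply: eq_bigr => l _; rewrite !ffunE permK.
Qed.

Lemma permop_unitary (g : 'S_m) : permop C D g *m (permop C D g)^t* = 1%:M.
Proof.
apply/matrixP => a b; rewrite !mxE.
under eq_bigr => c _ do rewrite !mxE rmorph_nat.
rewrite (sum_tbasis (fun c : T =>
  (tbasis a == [ffun l => c (g l)])%:R * (tbasis b == [ffun l => c (g l)])%:R : C)).
rewrite (bigD1 [ffun l => tbasis a ((g^-1)%g l)]) //= [X in _ + X]big1 ?addr0; last first.
  move=> c hc; case: eqP => [E|]; last by rewrite mul0r.
  case/eqP: hc; apply/ffunP => l; rewrite !ffunE E ffunE; by rewrite permKV.
have -> : [ffun l => [ffun l0 => tbasis a ((g^-1)%g l0)] (g l)] = tbasis a.
  by apply/ffunP => l; rewrite !ffunE permK.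
by rewrite eqxx mul1r (inj_eq tbasis_inj) eq_sym.
Qed.

Lemma permop_conj_tensop (g : 'S_m) A :
  permop C D g *m tensop A *m (permop C D g)^t* = tensop (A \o g).
Proof. by rewrite permop_tensop -mulmxA permop_unitary mulmx1. Qed.

Lemma perm_invariant_trace (rho : 'M[C]_(tdim D m)) (g : 'S_m) A :
  perm_invariant rho -> \tr (tensop (A \o g) *m rho) = \tr (tensop A *m rho).
Proof.
move=> inv; rewrite -{1}(inv g) !mulmxA -permop_tensop mxtrace_mulC !mulmxA.
by rewrite (mulmx1C (permop_unitary g)) mul1mx.
Qed.

End TensorOperators.

(** * Adjoints and positivity *)

Section Positivity.
Local Open Scope complex_scope.
Local Open Scope sesquilinear_scope.
Variables (C : numClosedFieldType) (M : nat).

Lemma adjmxM (p q r : nat) (A : 'M[C]_(p, q)) (B : 'M[C]_(q, r)) :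
  (A *m B)^t* = B^t* *m A^t*.
Proof. by rewrite trmx_mul map_mxM. Qed.

Lemma adjmxK (p q : nat) (A : 'M[C]_(p, q)) : (A^t*)^t* = A.
Proof. by apply/matrixP => i j; rewrite !mxE conjCK. Qed.

Lemma sqnorm_ge0 (v : 'cV[C]_M) : 0 <= (v^t* *m v) 0 0.
Proof. by rewrite mxE sumr_ge0 // => i _; rewrite !mxE mulrC mul_conjC_ge0. Qed.

Lemma projector_form_ge0 (E : 'M[C]_M) (v : 'cV[C]_M) :
  E^t* = E -> E *m E = E -> 0 <= (v^t* *m E *m v) 0 0.
Proof.
by move=> Ea EE; rewrite -EE -{1}Ea !mulmxA -adjmxM -mulmxA sqnorm_ge0.
Qed.

(** By cyclicity the trace is that of E rho E, whose diagonal entries are the quadratic form of rho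
    at the columns of E. *)
Lemma projector_trace_ge0 (E rho : 'M[C]_M) : density rho ->
  E^t* = E -> E *m E = E -> 0 <= \tr (E *m rho).
Proof.
move=> [pos _] Ea EE; rewrite -EE -mulmxA mxtrace_mulC -{1}Ea.
apply: sumr_ge0 => c _.
have := pos (col c E); rewrite (_ : _ 0 0 = (E^t* *m rho *m E) c c) //.
rewrite !mxE; apply: eq_bigr => j _; rewrite !mxE; congr (_ * _).
by apply: eq_bigr => i _; rewrite !mxE.
Qed.
End Positivity.

(** * Correspondence between states and weights on bad sets *)

Section BadSets.
Local Open Scope complex_scope.
Local Open Scope sesquilinear_scope.
Variables (R : realType) (D N : nat) (G : 'cV[R[i]]_D).
Hypothesis G1 : G^t* *m G = 1%:M.
Local Notation C := R[i].
Local Notation P := (target_proj G).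
Local Notation Q := (1%:M - target_proj G).
Implicit Types (x : {set 'I_N.+1}) (rho : 'M[C]_(tdim D N.+1)) (w : {set 'I_N.+1} -> R).

Definition bad_proj x : 'M[C]_(tdim D N.+1) := tensop (fun l => if l \in x then Q else P).

(** For a density operator this trace is a nonnegative real, so [Re] loses nothing. *)
Definition bad_weight rho x : R := complex.Re (\tr (bad_proj x *m rho)).

Lemma target_projM : P *m P = P.
Proof. by rewrite /target_proj mulmxA -(mulmxA G) G1 mulmx1. Qed.

Lemma target_proj_adj : P^t* = P.
Proof. by rewrite /target_proj adjmxM adjmxK. Qed.

Lemma compl_projM : Q *m Q = Q.
Proof. by rewrite mulmxBl mul1mx mulmxBr mulmx1 target_projM subrr subr0. Qed.

Lemma target_compl_proj : P *m Q = 0.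
Proof. by rewrite mulmxBr mulmx1 target_projM subrr. Qed.

Lemma compl_target_proj : Q *m P = 0.
Proof. by rewrite mulmxBl mul1mx target_projM subrr. Qed.

Lemma compl_proj_adj : Q^t* = Q.
Proof. by rewrite linearB /= map_mxB -/(P^t*) target_proj_adj trmx1 map_mx1. Qed.

Lemma mxtrace_target_proj : \tr P = 1.
Proof. by rewrite /target_proj mxtrace_mulC G1 mxtrace1. Qed.

Lemma mxtrace_compl_proj : \tr Q = D%:R - 1.
Proof. by rewrite linearB /= mxtrace1 mxtrace_target_proj. Qed.

Lemma bad_projM x : bad_proj x *m bad_proj x = bad_proj x.
Proof.
rewrite tensopM; apply: eq_tensop => l.
by case: ifP => _; [exact: compl_projM|exact: target_projM].
Qed.

Lemma bad_proj_adj x : (bad_proj x)^t* = bad_proj x.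
Proof.
rewrite tensop_adj; apply: eq_tensop => l.
by case: ifP => _; [exact: compl_proj_adj|exact: target_proj_adj].
Qed.

Lemma bad_proj_ortho x y : x != y -> \tr (bad_proj x *m bad_proj y) = 0.
Proof.
move=> xy; have [l ll] : exists l, (l \in x) != (l \in y).
  apply/existsP; apply: contraNT xy => /existsPn h; apply/eqP/setP => l.
  exact/eqP/negPn/h.
rewrite tensopM mxtrace_tensop (bigD1 l) //=.
by move: ll; case: (l \in x); case: (l \in y) => // _;
  rewrite ?target_compl_proj ?compl_target_proj mxtrace0 mul0r.
Qed.

Lemma mxtrace_bad_proj x : \tr (bad_proj x) = (D%:R - 1) ^+ #|x|.
Proof.
rewrite mxtrace_tensop -(prodr_const (mem x)) [RHS]big_mkcond /=.
by apply: eq_bigr => l _; case: ifP => _; rewrite ?mxtrace_compl_proj ?mxtrace_target_proj.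
Qed.

Lemma bad_weightE rho x : density rho -> \tr (bad_proj x *m rho) = (bad_weight rho x)%:C.
Proof.
move=> drho; have := projector_trace_ge0 drho (bad_proj_adj x) (bad_projM x).
by move/ger0_real/RRe_real.
Qed.

Lemma bad_weight_ge0 rho x : density rho -> 0 <= bad_weight rho x.
Proof.
move=> drho; rewrite -ler0c -bad_weightE //.
exact: projector_trace_ge0 (bad_proj_adj x) (bad_projM x).
Qed.

Lemma tensop_bad_weight rho (al be : 'I_N.+1 -> R) : density rho ->
  \tr (tensop (fun l => (al l)%:C *: P + (be l)%:C *: Q) *m rho) =
  (site_mean al be (bad_weight rho))%:C.
Proof.
move=> drho; rewrite tensop_distr mulmx_suml linear_sum rmorph_sum /=.
apply: eq_bigr => x _; rewrite -scalemxAl linearZ /= -/(bad_proj x) bad_weightE // rmorphM.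
congr (_ * _); rewrite /site_prod rmorph_prod.
by apply: eq_bigr => l _; case: ifP.
Qed.

Lemma sum_bad_weight rho : density rho -> \sum_x bad_weight rho x = 1.
Proof.
move=> drho; apply: (@complexI R).
have [_ tr1] := drho.
rewrite /= -[RHS]tr1 -[rho in RHS]mul1mx -tensop1.
rewrite (@eq_tensop _ _ _ _ (fun l => (1 : R)%:C *: P + (1 : R)%:C *: Q)); last first.
  by move=> l; rewrite !scale1r addrC subrK.
rewrite (tensop_bad_weight (fun=> 1) (fun=> 1)) //; congr (_%:C).
by apply: eq_bigr => x _; rewrite /site_prod big1 ?mul1r // => l _; case: ifP.
Qed.

Lemma bad_weight_exchangeable rho : perm_invariant rho -> exchangeable (bad_weight rho).
Proof.
move=> inv g x; congr complex.Re; rewrite -(perm_invariant_trace g _ inv).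
congr (\tr (_ *m _)); apply: eq_tensop => l /=.
by rewrite mem_imset //; exact: perm_inj.
Qed.

Lemma test_op_bad_weight (lambda a b : R) (A : 'M[C]_D) rho i : density rho ->
  A = a%:C *: P + b%:C *: Q ->
  \tr (test_op G lambda N i A *m rho) =
  (site_mean (test_al i a) (test_be (1 - lambda) i b) (bad_weight rho))%:C.
Proof.
move=> drho ->; rewrite -tensop_bad_weight //; congr (\tr (_ *m _)).
apply: eq_tensop => l; rewrite /test_al /test_be.
case: ifP => _; first by rewrite scale1r subKr.
case: ifP => _ //.
by rewrite scale0r add0r /Omegabar /Omega opprD addrA rmorphB scalerBl scale1r.
Qed.

Lemma test_sum_bad_weight (lambda a b : R) (A : 'M[C]_D) rho k : density rho ->
  A = a%:C *: P + b%:C *: Q ->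
  test_sum G lambda k A rho = (test_mean (1 - lambda) k a b (bad_weight rho))%:C.
Proof.
move=> drho EA; rewrite /test_sum /test_mean rmorph_sum; apply: eq_bigr => i _.
by rewrite rmorphM rmorph_nat (test_op_bad_weight lambda i drho EA).
Qed.

Lemma pk_bad_weight (lambda : R) rho k : density rho ->
  pk G lambda k rho = (test_mean (1 - lambda) k 1 1 (bad_weight rho))%:C.
Proof. by move=> drho; apply: test_sum_bad_weight => //; rewrite !scale1r addrC subrK. Qed.

Lemma fk_bad_weight (lambda : R) rho k : density rho ->
  fk G lambda k rho = (test_mean (1 - lambda) k 1 0 (bad_weight rho))%:C.
Proof. by move=> drho; apply: test_sum_bad_weight => //; rewrite scale1r scale0r addr0. Qed.

Hypothesis D2 : (2 <= D)%N.

(** A mixture of the normalised projectors [bad_proj x]. The trace (D - 1)^|x| is nonzero because D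
    >= 2. *)
Definition weight_state w : 'M[C]_(tdim D N.+1) :=
  \sum_x ((w x)%:C / (D%:R - 1) ^+ #|x|) *: bad_proj x.

Lemma D1_gt0 : 0 < D%:R - 1 :> C.
Proof. by rewrite subr_gt0 ltr1n. Qed.

Lemma bad_proj_weight_state w x : \tr (bad_proj x *m weight_state w) = (w x)%:C.
Proof.
rewrite mulmx_sumr linear_sum (bigD1 x) //= [X in _ + X]big1 ?addr0; last first.
  by move=> y yx; rewrite -scalemxAr linearZ /= bad_proj_ortho ?mulr0 // eq_sym.
rewrite -scalemxAr linearZ /= bad_projM mxtrace_bad_proj divfK //.
by rewrite expf_eq0 (gt_eqF D1_gt0) andbF.
Qed.

Lemma bad_weight_state w : bad_weight (weight_state w) = w.
Proof. by apply/funext => x; rewrite /bad_weight bad_proj_weight_state. Qed.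

Lemma weight_state_density w :
  (forall x, 0 <= w x) -> \sum_x w x = 1 -> density (weight_state w).
Proof.
move=> w0 w1; split=> [v|].
  rewrite mulmx_sumr mulmx_suml summxE; apply: sumr_ge0 => x _.
  rewrite -scalemxAr -scalemxAl mxE mulr_ge0 //.
    by rewrite divr_ge0 ?ler0c // exprn_ge0 // ltW // D1_gt0.
  exact: projector_form_ge0 (bad_proj_adj x) (bad_projM x).
rewrite linear_sum /= -[RHS](rmorph1 (real_complex R)) -w1 rmorph_sum /=; apply: eq_bigr => x _.
rewrite linearZ /= mxtrace_bad_proj divfK // expf_eq0 (gt_eqF D1_gt0) andbF //.
Qed.

Lemma weight_state_perm_invariant w : exchangeable w -> perm_invariant (weight_state w).
Proof.
move=> wx g; rewrite mulmx_sumr mulmx_suml [LHS](reindex_inj (imset_inj (@perm_inj _ g))) /=.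
apply: eq_bigr => x _; rewrite -scalemxAr -scalemxAl permop_conj_tensop wx.
rewrite card_imset; last exact: perm_inj.
congr (_ *: _); apply: eq_tensop => l /=.
by rewrite mem_imset //; exact: perm_inj.
Qed.

End BadSets.

(** * Graph states *)

Section DiagonalUnitaries.
Variable C : numClosedFieldType.

(** Such matrices preserve the modulus of every amplitude, which is all that the norm of the graph
    state depends on. *)
Definition phase_mx M (A : 'M[C]_M) : Prop :=
  exists2 u : 'rV[C]_M, A = diag_mx u & forall i, `|u 0 i| = 1.

Lemma phase_mx1 M : phase_mx (1%:M : 'M[C]_M).
Proof. by exists (const_mx 1) => [|i]; rewrite ?diag_const_mx // mxE normr1. Qed.

Lemma phase_mxM M (A B : 'M[C]_M) : phase_mx A -> phase_mx B -> phase_mx (A *m B).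
Proof.
move=> [u -> u1] [v -> v1]; rewrite mulmx_diag.
by exists (\row_j (u 0 j * v 0 j)) => // i; rewrite mxE normrM u1 v1 mulr1.
Qed.

Lemma phase_mxX M (A : 'M[C]_M) k : phase_mx A -> phase_mx (A ^+ k).
Proof.
by move=> hA; elim: k => [|k IH]; [exact: phase_mx1|rewrite exprS; exact: phase_mxM].
Qed.

Lemma phase_mx_prod M (I : finType) (P : pred I) (F : I -> 'M[C]_M) :
  (forall i, P i -> phase_mx (F i)) -> phase_mx (\prod_(i | P i) F i).
Proof. by move=> h; elim/big_ind: _ => //; [exact: phase_mx1 | exact: phase_mxM]. Qed.

Lemma diag_mxX M (u : 'rV[C]_M) k : diag_mx u ^+ k = diag_mx (\row_j u 0 j ^+ k).
Proof.
elim: k => [|k IH].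
  by rewrite expr0 -[1]/(1%:M) -diag_const_mx; congr diag_mx; apply/rowP => j; rewrite !mxE.
rewrite exprS IH -[_ * _]/(_ *m _) mulmx_diag; congr diag_mx; apply/rowP => j.
by rewrite !mxE exprS.
Qed.

Lemma tensop_diag D m (r : 'I_m -> 'rV[C]_D) :
  tensop (fun l => diag_mx (r l)) = diag_mx (\row_a \prod_l r l 0 (tbasis a l)).
Proof.
apply/matrixP => a b; rewrite !mxE; case: (eqVneq a b) => [->|ab].
  by rewrite mulr1n; apply: eq_bigr => l _; rewrite !mxE eqxx mulr1n.
have /forallPn[l ll] : ~~ [forall l, tbasis a l == tbasis b l].
  apply: contraNN ab => /forallP h; apply/eqP/tbasis_inj/ffunP => l; exact/eqP/h.
by rewrite (bigD1 l) //= mxE (negbTE ll) mulr0n mul0r.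
Qed.
End DiagonalUnitaries.

Section GraphStateNorm.
Local Open Scope complex_scope.
Local Open Scope sesquilinear_scope.
Variables (R : realType) (d n : nat).
Local Notation C := R[i].

Lemma norm_omega : `|omega R d| = 1.
Proof. by rewrite normc_def /= cos2Dsin2 sqrtr1. Qed.

Lemma siteop_diag (i : 'I_n) (u : 'rV[C]_d) :
  siteop i (diag_mx u) = diag_mx (\row_a u 0 (tbasis a i)).
Proof.
have E l : (if l == i then diag_mx u else 1%:M) = diag_mx (if l == i then u else const_mx 1).
  by case: ifP => // _; rewrite diag_const_mx.
rewrite /siteop (eq_tensop E).
rewrite tensop_diag; congr diag_mx; apply/rowP => a; rewrite !mxE.
rewrite (bigD1 i) //= eqxx big1 ?mulr1 // => l /negbTE ->; by rewrite mxE.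
Qed.

Lemma phase_mx_CZ (e : 'I_n * 'I_n) : phase_mx (CZ R d e).
Proof.
have ZE : Zop R d = diag_mx (\row_b omega R d ^+ b).
  by apply/matrixP => a b; rewrite !mxE; case: eqVneq => [->|_].
have dE (k : 'I_d) : delta_mx k k = diag_mx (\row_j (j == k)%:R) :> 'M[C]_d.
  apply/matrixP => a b; rewrite !mxE; case: (eqVneq a b) => [->|ab]; first by rewrite andbb.
  by rewrite mulr0n; case: (a =P k) ab => [->|] //; rewrite eq_sym => /negbTE ->.
exists (\row_a (omega R d ^+ tbasis a e.2) ^+ tbasis a e.1); last first.
  by move=> i; rewrite mxE !normrX norm_omega !expr1n.
rewrite /CZ (eq_bigr (fun k : 'I_d => diag_mx
   (\row_a ((tbasis a e.1 == k)%:R * (omega R d ^+ tbasis a e.2) ^+ k)))); last first.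
  move=> k _; rewrite ZE dE diag_mxX !siteop_diag mulmx_diag; congr diag_mx.
  by apply/rowP => a; rewrite !mxE.
rewrite -linear_sum; congr diag_mx; apply/rowP => a; rewrite summxE !mxE.
rewrite (bigD1 (tbasis a e.1)) //= mxE eqxx mul1r big1 ?addr0 // => k /negbTE.
by rewrite mxE eq_sym => ->; rewrite mul0r.
Qed.

(** Each of the d^n amplitudes has squared modulus d^-n, as the controlled phases only change
    arguments. *)
Lemma graph_state_norm (E : {set 'I_n * 'I_n}) (mult : 'I_n * 'I_n -> 'I_d) :
  (0 < d)%N -> (graph_state R E mult)^t* *m graph_state R E mult = 1%:M.
Proof.
move=> d0.
have : phase_mx (\prod_(e in E) CZ R d e ^+ mult e).
  by apply: phase_mx_prod => e _; apply: phase_mxX; exact: phase_mx_CZ.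
rewrite /graph_state => -[u -> u1].
apply/matrixP => i j; rewrite !ord1 !mxE eqxx.
transitivity (\sum_(a < tdim d n) ((d%:R : C) ^+ n)^-1).
  apply: eq_bigr => a _; rewrite mul_diag_mx !mxE.
  rewrite mulrC -normCK normrM u1 mul1r normr_prod.
  rewrite (eq_bigr (fun=> ((Num.sqrt (d%:R : R))^-1)%:C)); last first.
    by move=> l _; rewrite mxE ger0_norm // ler0c invr_ge0 sqrtr_ge0.
  rewrite prodr_const card_ord -exprM mulnC exprM -rmorphXn /= exprVn sqr_sqrtr ?ler0n //.
  by rewrite fmorphV rmorph_nat exprVn.
rewrite sumr_const card_ord /tdim card_ffun !card_ord -[_ *+ _]mulr_natl natrX mulfV //.
by rewrite expf_eq0 pnatr_eq0 (gtn_eqF d0) andbF.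
Qed.

Lemma tdim_ge2 : prime d -> (1 <= n)%N -> (2 <= tdim d n)%N.
Proof.
move=> /prime_gt1 d1 n0; rewrite /tdim card_ffun !card_ord.
by apply: (leq_trans d1); rewrite -{1}[d]expn1 leq_exp2l.
Qed.
End GraphStateNorm.

(** * Guaranteed infidelity *)

Section GuaranteedInfidelity.
Local Open Scope complex_scope.
Local Open Scope sesquilinear_scope.
Variables (R : realType) (D N k : nat) (G : 'cV[R[i]]_D) (lambda delta : R).
Implicit Types w : {set 'I_N.+1} -> R.

Definition admissible_weight w : Prop :=
  [/\ forall x, 0 <= w x, \sum_x w x = 1, exchangeable w &
    delta <= test_mean (1 - lambda) k 1 1 w].

Definition weight_fidelity w : R :=
  test_mean (1 - lambda) k 1 0 w / test_mean (1 - lambda) k 1 1 w.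

Lemma test_mean_linear nu a b w : test_mean nu k a b w =
  \sum_x (\sum_(0 <= i < k.+1) 'C(N, i)%:R * site_prod (test_al i a) (test_be nu i b) x) * w x.
Proof.
rewrite /test_mean; under eq_bigr => i _ do rewrite /site_mean big_distrr /=.
rewrite exchange_big /=; apply: eq_bigr => x _; rewrite big_distrl /=.
by apply: eq_bigr => i _; rewrite mulrA.
Qed.

Hypotheses (G1 : G^t* *m G = 1%:M) (D2 : (2 <= D)%N) (delta0 : 0 < delta).

(** [bad_weight] sends admissible states to admissible weights of equal fidelity, and [weight_state]
    provides a state for each weight. The minimum over states is therefore the one over weights,
    which [simplex_ratio_min] shows to be attained. *)
Lemma guaranteed_infidelity_weight : (exists w, admissible_weight w) ->
  exists2 w, admissible_weight w &
    is_guaranteed_infidelity G lambda k N delta (1 - weight_fidelity w) /\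
    forall w', admissible_weight w' -> weight_fidelity w <= weight_fidelity w'.
Proof.
move=> [w0 adm0].
pose rel (x y : {set 'I_N.+1}) := exists g : {perm 'I_N.+1}, x = g @: y.
pose coef (b : R) (x : {set 'I_N.+1}) : R := \sum_(0 <= i < k.+1)
  'C(N, i)%:R * site_prod (test_al i 1) (test_be (1 - lambda) i b) x.
have admP w : admissible_weight w <-> [/\ forall x, 0 <= w x, \sum_x w x = 1,
     forall x y, rel x y -> w x = w y & delta <= \sum_x coef 1 x * w x].
  rewrite /admissible_weight test_mean_linear; split=> -[h1 h2 h3 h4]; split=> //.
    by move=> x y [g ->]; exact: h3.
  by move=> g x; apply: h3; exists g.
have [|w /admP adm wmin] := @simplex_ratio_min R _ rel (coef 1) (coef 0) delta delta0.
  by exists w0; apply/admP.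
have {}wmin w' : admissible_weight w' -> weight_fidelity w <= weight_fidelity w'.
  by move=> /admP/wmin; rewrite /weight_fidelity !test_mean_linear.
exists w => //; split=> //.
have FkE rho : density rho -> Fk G lambda k rho = (weight_fidelity (bad_weight G rho))%:C.
  by move=> drho; rewrite /Fk fk_bad_weight // pk_bad_weight // /weight_fidelity rmorphM fmorphV.
rewrite /is_guaranteed_infidelity subKr; split.
  have [w_ge0 w1 wx wp] := adm.
  have dw := weight_state_density G1 D2 w_ge0 w1.
  exists (weight_state G w); last by rewrite FkE // bad_weight_state.
  split=> //; first exact: weight_state_perm_invariant.
  by rewrite pk_bad_weight // bad_weight_state // lecR.
move=> rho [drho inv]; rewrite pk_bad_weight // lecR => pd.
rewrite FkE // lecR; apply: wmin; split=> //.
- by move=> x; exact: bad_weight_ge0.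
- exact: sum_bad_weight.
- exact: bad_weight_exchangeable.
Qed.
End GuaranteedInfidelity.

(** * The two bounds on the infidelity *)

Section Bounds.
Variables (R : realType) (N : nat) (s lambda delta : R).
Hypotheses (s01 : 0 < s < 1) (l01 : 0 < lambda < 1).
Hypotheses (d01 : 0 < delta <= 1 / 4) (N1 : (1 <= N)%N).
Local Notation nu := (1 - lambda).
Local Notation k := (Num.truncn (nu * s * N%:R)).

Lemma trunc_bounds : k%:R <= nu * s * N%:R < k.+1%:R.
Proof.
apply: truncn_itv; move: s01 l01 => /andP[s0 _] /andP[_ l1].
by rewrite !mulr_ge0 // ?subr_ge0 // ltW.
Qed.

Lemma trunc_lt : (k < N)%N.
Proof.
have /andP[h _] := trunc_bounds; rewrite -(ltr_nat R); apply: le_lt_trans h _.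
rewrite gtr_pMl ?ltr0n //; move: s01 l01 => /andP[s0 s1] /andP[l0 l1].
by nra.
Qed.

(** Since nu r = k / N, [binomial_mean_quarter] bounds p_k below by 1/4. The last site is
    independent of the tests, hence the fidelity 1 - r. *)
Lemma iid_admissible (r := k%:R / (nu * N%:R)) :
  admissible_weight k lambda delta (@iid_weight R N r) /\
  weight_fidelity k lambda (@iid_weight R N r) = 1 - r.
Proof.
have [/andP[s0 s1] /andP[l0 l1] /andP[d0 d1]] := And3 s01 l01 d01.
have nu0 : 0 < nu by rewrite subr_gt0.
have N0 : 0 < N%:R :> R by rewrite ltr0n.
have kN := trunc_lt.
have /andP[kle _] := trunc_bounds.
have r01 : 0 <= r <= 1.
  rewrite divr_ge0 ?mulr_ge0 ?ler0n ?(ltW nu0) //= ler_pdivrMr ?mulr_gt0 // mul1r.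
  by apply: (le_trans kle); rewrite mulrAC ler_piMr // ?mulr_ge0 // ltW.
have nur : nu * r = k%:R / N%:R.
  by rewrite /r; field; rewrite !gt_eqF.
have := @binomial_mean_quarter R N k kN; rewrite -nur.
set S := \sum_(0 <= i < _) _ => S4.
have S0 : 0 < S by apply: lt_le_trans S4; rewrite divr_gt0.
rewrite /admissible_weight /weight_fidelity !test_mean_iid ?(ltnW kN) // -/S; split.
  split.
  - by move=> x; exact: iid_weight_ge0.
  - exact: sum_iid_weight.
  - exact: exchangeable_iid.
  - by rewrite !mul1r addrC subrK mulr1; exact: le_trans S4.
by rewrite !mul1r mul0r add0r [r + _]addrC subrK mulr1 mulrC mulKf // gt_eqF.
Qed.

(** This is [bad_mean_le] at L = ln (1 / delta) with the parameters of [chernoff_parameters], whose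
    quantity w is lambda N times the sum of the two error terms. *)
Lemma infidelity_le (w : {set 'I_N.+1} -> R) : admissible_weight k lambda delta w ->
  1 - weight_fidelity k lambda w <= s + 1 / (nu * lambda) * Num.sqrt (s * ln delta^-1 / N%:R)
        + ln delta^-1 / (2 * nu ^+ 2 * lambda * N%:R).
Proof.
move=> [w0 w1 wx pd].
have [/andP[s0 s1] /andP[l0 l1] /andP[d0 d1]] := And3 s01 l01 d01.
have nu0 : 0 < nu by rewrite subr_gt0.
have nu1 : nu < 1 by lra.
have N0 : 0 < N%:R :> R by rewrite ltr0n.
have /andP[kle _] := trunc_bounds.
set L := ln delta^-1.
have eL : expR (- L) = delta by rewrite /L lnV ?posrE // opprK lnK.
(* Here delta <= 1/4 enters: e^(-1/2) >= 1/2, so e^-1 >= 1/4 >= delta. *)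
have L1 : 1 <= L.
  rewrite -lerN2 -ler_expR eL; apply: (le_trans d1).
  have h : 1 / 2 <= expR (- (1 / 2)) :> R by have := @expR_ge1Dx R (- (1 / 2)); lra.
  have -> : expR (- 1) = expR (- (1 / 2)) * expR (- (1 / 2)) :> R.
    by rewrite -expRD; congr expR; lra.
  by have := @expR_ge0 R (- (1/2)); nra.
have nu01' : 0 < nu < 1 by rewrite nu0 nu1.
have [a [b [a0 b0 ab h]]] := chernoff_parameters nu01' s0 (lt_le_trans ltr01 L1) N0.
have nu01 : 0 <= nu <= 1 by rewrite !ltW.
have := @bad_mean_le R N nu nu01 k a b L w w0 w1 wx (ltnW trunc_lt) b0 L1 ab.
rewrite eL => /(_ pd); rewrite subKr.
(* Splitting p_k by the state of the last site gives p = f + e, so the infidelity is e / p. *)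
have pE := @test_meanD R N nu k 1 0 0 1 w; rewrite addr0 add0r in pE.
rewrite /weight_fidelity pE; rewrite pE in pd.
set p := _ + test_mean nu k 0 1 w in pd *; set e := test_mean nu k 0 1 w in p pd *.
move=> he.
have p0 : 0 < p by exact: lt_le_trans pd.
have -> : 1 - test_mean nu k 1 0 w / p = e / p by rewrite /p; field; rewrite gt_eqF.
pose w' := Num.sqrt (s * N%:R * L) / nu + L / (2 * nu ^+ 2).
have e1 : lambda * (N.+1%:R * e) <= (s * N%:R * lambda + w') * p.
  rewrite -(ler_pM2l a0); apply: (le_trans he).
  rewrite mulrA [a * _]mulrC ler_wpM2r ?(ltW p0) //.
  rewrite subKr in h.
  by apply: le_trans h; rewrite lerD2l ler_wpM2l.
(* Nonnegativity allows N + 1 to be lowered to N at the end. *)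
have e_ge0 : 0 <= e.
  apply: sumr_ge0 => i _; rewrite mulr_ge0 //; apply: sumr_ge0 => x _; rewrite mulr_ge0 //.
  apply: site_prod_ge0 => l; rewrite /test_al /test_be; case: ifP => _; rewrite ?subKr ?(ltW l0) //.
    by case: ifP.
  by case: ifP => _; rewrite ?(ltW nu0).
have -> : s + 1 / (nu * lambda) * Num.sqrt (s * L / N%:R) + L / (2 * nu ^+ 2 * lambda * N%:R)
   = (s * N%:R * lambda + w') / (lambda * N%:R).
  rewrite /w'.
  have -> : Num.sqrt (s * N%:R * L) = Num.sqrt (s * L / N%:R) * N%:R.
    rewrite -[X in _ = _ * X](ger0_norm (ltW N0)) -sqrtr_sqr.
    rewrite -sqrtrM; last first.
      by rewrite divr_ge0 ?mulr_ge0 ?(ltW N0) // ltW // (lt_le_trans ltr01 L1).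
    by congr Num.sqrt; field; rewrite gt_eqF.
  by field; rewrite !gt_eqF.
rewrite ler_pdivrMr // mulrAC ler_pdivlMr ?mulr_gt0 // mulrC; apply: le_trans e1.
by rewrite mulrA ler_wpM2r // ler_wpM2l ?(ltW l0) // ler_nat.
Qed.
End Bounds.

Theorem theorem1 (R : realType) (d n : nat)
    (E : {set 'I_n * 'I_n}) (mult : 'I_n * 'I_n -> 'I_d)
    (s lambda delta : R) (N : nat) :
  prime d -> (1 <= n)%N ->
  (forall e, e \in E -> e.1 != e.2) ->
  0 < s < 1 -> 0 < lambda < 1 -> 0 < delta <= 1 / 4 -> (1 <= N)%N ->
  let nu := 1 - lambda in
  let k := Num.truncn (nu * s * N%:R) in
  exists2 eps : R,
    is_guaranteed_infidelity (graph_state R E mult) lambda k N delta eps &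
    s - 1 / (nu * N%:R) < eps <=
      s + 1 / (nu * lambda) * Num.sqrt (s * ln delta^-1 / N%:R)
        + ln delta^-1 / (2 * nu ^+ 2 * lambda * N%:R)
        + 2 / (lambda * N%:R).
Proof.
move=> pd n1 _ s01 l01 d01 N1 nu k.
have [iid_adm iidE] := iid_admissible s01 l01 d01 N1.
have /andP[d0 _] := d01.
have [w adm [isw wmin]] := guaranteed_infidelity_weight (graph_state_norm R E mult (prime_gt0 pd))
  (tdim_ge2 pd n1) d0 (ex_intro _ _ iid_adm).
exists (1 - weight_fidelity k lambda w) => //.
have N0 : 0 < N%:R :> R by rewrite ltr0n.
have [/andP[l0 l1]] := l01.
have nu0 : 0 < nu by rewrite subr_gt0.
apply/andP; split; last first.
  apply: (le_trans (infidelity_le s01 l01 d01 N1 adm)).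
  by rewrite lerDl divr_ge0 // ltW // mulr_gt0.
have := wmin _ iid_adm; rewrite iidE.
have /andP[_] := trunc_bounds N s01 l01.
rewrite -/nu -/k -[k.+1%:R]natr1 => hk hw.
(* The minimal fidelity is at most that of the independent weight, so the infidelity is at least k /
   (nu N), and k + 1 > nu s N. *)
apply: (@lt_le_trans _ _ (k%:R / (nu * N%:R))); last by move: hw; lra.
rewrite ltrBlDr -mulrDl ltr_pdivlMr ?mulr_gt0 //.
by rewrite mulrA [s * nu]mulrC.
Qed.
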